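(* Assume $\Bbbk$ has characteristic zero. For every $t\in\mathbb N$ there is a short exact sequence of $\Bbbk\mathbf{FA}$-modules $$0\to\Lambda^t(\overline P)\to\Lambda^t(P^{\mathbf{FA}})\to\Lambda^{t-1}(\overline P)\to0,$$ induced by $0\to\overline P\to P^{\mathbf{FA}}\to\overline\Bbbk\to0$ (for $t=0$ this is $0\to\overline\Bbbk\to\Bbbk\to\Bbbk_{\mathbf 0}\to0$), and $\Lambda^t(P^{\mathbf{FA}})\to\Lambda^{t-1}(\overline P)$ is a projective cover of the simple functor $\Lambda^{t-1}(\overline P)$; in particular $\Lambda^t(P^{\mathbf{FA}})$ is an indecomposable projective.
   Context: Let $\Bbbk$ be a field. $\mathbf{FA}$ denotes the category of finite sets and all maps, and $\mathbf{FI}$, $\mathbf{FS}$, $\mathbf{FB}$ its wide subcategories of injections, surjections and bijections respectively; $\mathbf n=\{1,\dots,n\}$ for $n\in\mathbb N$ ($\mathbf 0=\emptyset$), and $\mathfrak S_n$ is the symmetric group. For a category $\mathcal C$, $\Bbbk\mathcal C(X,Y)$ is the $\Bbbk$-vector space with basis $\mathcal C(X,Y)$. A $\Bbbk\mathbf{FA}$-module is a functor from $\mathbf{FA}$ to $\Bbbk$-vector spaces (these form the abelian category $\mathcal F(\mathbf{FA})$); $\otimes$ denotes the pointwise tensor product over $\Bbbk$, and $\hom_{\Bbbk\mathbf{FA}}$ denotes natural transformations. $P^{\mathbf{FA}}_{\mathbf n}:=\Bbbk\mathbf{FA}(\mathbf n,-)$, so $P^{\mathbf{FA}}_{\mathbf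 n}(X)\cong\Bbbk[X]^{\otimes n}$ (where $\Bbbk[X]$ has basis $\{[x]:x\in X\}$), with the right $\mathfrak S_n$-action by precomposition, equivalently place permutation of tensor factors; write $P^{\mathbf{FA}}:=P^{\mathbf{FA}}_{\mathbf 1}$. Let $\overline{\Bbbk}$ be the functor with value $\Bbbk$ on non-empty sets (all maps acting by the identity) and $0$ on $\emptyset$, and $\Bbbk_{\mathbf 0}$ the functor with value $\Bbbk$ on $\emptyset$ and $0$ on non-empty sets. $\overline P$ is the kernel of the surjection $P^{\mathbf{FA}}\to\overline\Bbbk$, $[x]\mapsto 1$; thus $\overline P(X)=\{\sum_x a_x[x]:\sum_x a_x=0\}$. For $n\ge1$, $\overline P^{\otimes n}$ is the $n$-fold pointwise tensor power, a subfunctor of $P^{\mathbf{FA}}_{\mathbf n}$ stable under the place-permutation right action of $\mathfrak S_n$; by convention $\overline P^{\otimes 0}:=\overline\Bbbk$. For a partition $\lambda\vdash n$, $S_\lambda$ is the associated simple $\Bbbk\mathfrak S_n$-module, with $S_{(n)}$ trivial and $S_{(1^n)}=\mathsf{sgn}_n$ the sign representation. For a $\Bbbk\mathbf{FA}$-module $F$, $S_\lambda(F):=F^{\otimes n}\otimes_{\mathfrak S_n}S_\lambda$ (using the place-permutation right action on $F^{\otimes n}$), and $\Lambda^n(F):=S_{(1^n)}(F)$ is the $n$-th exterior power; conventions: $\Lambda^0(P^{\mathbf{FA}})=\Bbbk$ (the constant functor), $\Lambda^0(\overline P)=\overline\Bbbk$, $\Lambda^{-1}(\overline P)=\Bbbk_{\mathbf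 0}$. *)

(* Defs.v *)
From HB Require Import structures.
From mathcomp Require Import all_boot all_order all_algebra fingroup perm.
Set Implicit Arguments. Unset Strict Implicit. Unset Printing Implicit Defensive.
Import Order.TTheory GRing.Theory Num.Theory.
Local Open Scope ring_scope.

(* kFA-modules.  We use the skeleton of FA (objects n = {0,..,n-1} = 'I_n,    *)
(* morphisms all maps {ffun 'I_m -> 'I_n}), which is equivalent to FA.       *)
(* A module is given as a sub-quotient presentation: at each n an ambient     *)
(* K-vector space FV n, a subspace Fdom n and a subspace Fnull n <= Fdom n;   *)
(* the actual value of the functor at n is Fdom n / Fnull n.  With           *)
(* Fnull = 0 and Fdom = everything this is an ordinary functor, so every     *)
(* kFA-module arises this way.  The axioms (functoriality etc.) are stated    *)
(* modulo Fnull in the predicate [isFAmod].                                   *)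

Record FAraw (K : fieldType) := FARaw {
  FV : nat -> lmodType K;
  Fdom : forall n, FV n -> Prop;
  Fnull : forall n, FV n -> Prop;
  Fact : forall m n, {ffun 'I_m -> 'I_n} -> FV m -> FV n
}.
Arguments FARaw {K}.
Arguments FV {K} _ _.
Arguments Fdom {K} _ _ _.
Arguments Fnull {K} _ _ _.
Arguments Fact {K} _ {_ _} _ _.

Definition ffid (n : nat) : {ffun 'I_n -> 'I_n} := [ffun i => i].
Definition ffcomp (m n p : nat) (g : {ffun 'I_n -> 'I_p}) (f : {ffun 'I_m -> 'I_n})
  : {ffun 'I_m -> 'I_p} := [ffun i => g (f i)].

Definition subspaceP (K : fieldType) (V : lmodType K) (S : V -> Prop) :=
  S 0 /\ forall (a : K) (x y : V), S x -> S y -> S (a *: x + y).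

Definition isFAmod (K : fieldType) (M : FAraw K) : Prop :=
  (forall n, subspaceP (Fdom M n)) /\
  (forall n, subspaceP (Fnull M n)) /\
  (forall n x, Fnull M n x -> Fdom M n x) /\
  (forall m n (f : {ffun 'I_m -> 'I_n}) x, Fdom M m x -> Fdom M n (Fact M f x)) /\
  (forall m n (f : {ffun 'I_m -> 'I_n}) x, Fnull M m x -> Fnull M n (Fact M f x)) /\
  (forall m n (f : {ffun 'I_m -> 'I_n}) (a : K) x y, Fdom M m x -> Fdom M m y ->
      Fnull M n (Fact M f (a *: x + y) - (a *: Fact M f x + Fact M f y))) /\
  (forall n x, Fdom M n x -> Fnull M n (Fact M (ffid n) x - x)) /\
  (forall m n p (f : {ffun 'I_m -> 'I_n}) (g : {ffun 'I_n -> 'I_p}) x, Fdom M m x ->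
      Fnull M p (Fact M (ffcomp g f) x - Fact M g (Fact M f x))).

Definition famT (K : fieldType) (M N : FAraw K) := forall n, FV M n -> FV N n.

Definition isHom (K : fieldType) (M N : FAraw K) (phi : famT M N) : Prop :=
  (forall n x, Fdom M n x -> Fdom N n (phi n x)) /\
  (forall n x, Fnull M n x -> Fnull N n (phi n x)) /\
  (forall n (a : K) x y, Fdom M n x -> Fdom M n y ->
      Fnull N n (phi n (a *: x + y) - (a *: phi n x + phi n y))) /\
  (forall m n (f : {ffun 'I_m -> 'I_n}) x, Fdom M m x ->
      Fnull N n (phi n (Fact M f x) - Fact N f (phi m x))).

Definition hsurj (K : fieldType) (M N : FAraw K) (phi : famT M N) : Prop :=
  forall n y, Fdom N n y -> exists x, Fdom M n x /\ Fnull N n (phi n x - y).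

Definition hinj (K : fieldType) (M N : FAraw K) (phi : famT M N) : Prop :=
  forall n x, Fdom M n x -> Fnull N n (phi n x) -> Fnull M n x.

Definition hexact (K : fieldType) (L M N : FAraw K) (phi : famT L M) (psi : famT M N) :=
  forall n y, Fdom M n y ->
    (Fnull N n (psi n y) <-> exists x, Fdom L n x /\ Fnull M n (phi n x - y)).

Definition isSES (K : fieldType) (L M N : FAraw K) (phi : famT L M) (psi : famT M N) :=
  hinj phi /\ hexact phi psi /\ hsurj psi.

Definition isZeroMod (K : fieldType) (M : FAraw K) : Prop :=
  forall n x, Fdom M n x -> Fnull M n x.

Definition isSubmod (K : fieldType) (M : FAraw K) (S : forall n, FV M n -> Prop) :=
  (forall n, subspaceP (S n)) /\
  (forall n x, S n x -> Fdom M n x) /\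
  (forall n x, Fnull M n x -> S n x) /\
  (forall m n (f : {ffun 'I_m -> 'I_n}) x, S m x -> S n (Fact M f x)).

Arguments isSubmod {K} M S.

Definition isSimple (K : fieldType) (M : FAraw K) : Prop :=
  ~ isZeroMod M /\
  forall S, isSubmod M S ->
    (forall n x, S n x -> Fnull M n x) \/ (forall n x, Fdom M n x -> S n x).

Definition isIndecomposable (K : fieldType) (M : FAraw K) : Prop :=
  ~ isZeroMod M /\
  forall S1 S2, isSubmod M S1 -> isSubmod M S2 ->
    (forall n x, S1 n x -> S2 n x -> Fnull M n x) ->
    (forall n x, Fdom M n x ->
       exists y z, S1 n y /\ S2 n z /\ Fnull M n (x - (y + z))) ->
    (forall n x, S1 n x -> Fnull M n x) \/ (forall n x, S2 n x -> Fnull M n x).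

Definition isProjective (K : fieldType) (P : FAraw K) : Prop :=
  forall (M N : FAraw K) (e : famT M N) (g : famT P N),
    isFAmod M -> isFAmod N -> isHom e -> isHom g -> hsurj e ->
    exists h : famT P M, isHom h /\
      forall n x, Fdom P n x -> Fnull N n (e n (h n x) - g n x).

Definition isProjCover (K : fieldType) (P S : FAraw K) (p : famT P S) : Prop :=
  isProjective P /\ isHom p /\ hsurj p /\
  forall (M : FAraw K) (g : famT M P), isFAmod M -> isHom g ->
    hsurj (fun n x => p n (g n x) : FV S n) -> hsurj g.

(* P(n) = K['I_n] = {ffun 'I_n -> K};  P_t(n) = P(n)^{(x) t} = K[('I_n)^t],   *)
(* i.e. functions on {ffun 'I_t -> 'I_n}, with basis delta_x.                 *)

Definition Pn (K : fieldType) (n : nat) : lmodType K := {ffun 'I_n -> K^o}.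
Definition Vt (K : fieldType) (t n : nat) : lmodType K :=
  {ffun {ffun 'I_t -> 'I_n} -> K^o}.

Definition delta1 (K : fieldType) (n : nat) (a : 'I_n) : Pn K n :=
  [ffun b => (b == a)%:R].

(* covariant action of f : 'I_m -> 'I_n on P_t : delta_x |-> delta_{f o x} *)
Definition pushT (K : fieldType) (t m n : nat) (f : {ffun 'I_m -> 'I_n})
  (v : Vt K t m) : Vt K t n :=
  [ffun y => \sum_(x : {ffun 'I_t -> 'I_m} | ffcomp f x == y) v x].

(* place permutation of tensor factors: delta_x |-> delta_{x o s} *)
Definition permV (K : fieldType) (t n : nat) (s : 'S_t) (v : Vt K t n) : Vt K t n :=
  [ffun y : {ffun 'I_t -> 'I_n} => v [ffun i => y ((s^-1)%g i)]].

Definition sgn (K : fieldType) (t : nat) (s : 'S_t) : K := (-1) ^+ odd_perm s.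

Definition tens (K : fieldType) (t n : nat) (w : 'I_t -> Pn K n) : Vt K t n :=
  [ffun y : {ffun 'I_t -> 'I_n} => \prod_(i < t) w i (y i)].

Inductive spanP (K : fieldType) (V : lmodType K) (S : V -> Prop) : V -> Prop :=
  | span0 : spanP S 0
  | span_gen v : S v -> spanP S v
  | span_comb (a : K) u v : spanP S u -> spanP S v -> spanP S (a *: u + v).

Definition inPbar (K : fieldType) (n : nat) (w : Pn K n) : Prop := \sum_j w j = 0.

(* Pbar^{(x) t}(n) as a subspace of P_t(n); convention Pbar^{(x) 0} = kbar *)
Definition PbarT (K : fieldType) (t n : nat) (v : Vt K t n) : Prop :=
  if t == 0%N then (0 < n)%N \/ v = 0
  else spanP (fun u => exists w : 'I_t -> Pn K n,
                         (forall i, inPbar (w i)) /\ u = tens w) v.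

(* Lambda^t(F) = F^{(x) t} (x)_{S_t} sgn, for F^{(x)t} = D a subfunctor of P_t:
   the quotient of D by the span of  v.s - sgn(s) v . *)
Definition LamOf (K : fieldType) (t : nat) (D : forall n, Vt K t n -> Prop) : FAraw K :=
  FARaw (Vt K t) D
    (fun n => spanP (fun u => exists (s : 'S_t) (v : Vt K t n),
                                D n v /\ u = permV s v - sgn K s *: v))
    (fun m n f v => pushT f v).

Definition LamP (K : fieldType) (t : nat) : FAraw K := @LamOf K t (fun _ _ => True).
Definition LamPbar (K : fieldType) (t : nat) : FAraw K := @LamOf K t (@PbarT K t).
(* k_0 = k / kbar *)
Definition Kzero (K : fieldType) : FAraw K :=
  FARaw (Vt K 0) (fun _ _ => True) (fun n v => (0 < n)%N \/ v = 0)
        (fun m n f v => pushT f v).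
(* Lambda^{t-1}(Pbar), with Lambda^{-1}(Pbar) = k_0 *)
Definition LamPbarPred (K : fieldType) (t : nat) : FAraw K :=
  match t with 0 => Kzero K | s.+1 => LamPbar K s end.

Definition inclMap (K : fieldType) (t : nat) : famT (LamPbar K t) (LamP K t) :=
  fun n v => v.

(* the map Lambda^t(P) -> Lambda^{t-1}(Pbar) induced by P -> kbar:
   [x_0] /\ ... /\ [x_{t-1}]  |->  ([x_1]-[x_0]) /\ ... /\ ([x_{t-1}]-[x_0]);
   for t = 0 it is the projection k -> k_0. *)
Definition dMap (K : fieldType) (t : nat) : famT (LamP K t) (LamPbarPred K t) :=
  match t return famT (LamP K t) (LamPbarPred K t) with
  | 0 => fun n v => v
  | s.+1 => fun n v =>
      \sum_(x : {ffun 'I_s.+1 -> 'I_n})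
         v x *: tens (fun i : 'I_s => delta1 K (x (lift ord0 i)) - delta1 K (x ord0))
  end.

Arguments inclMap K t : clear implicits.
Arguments dMap K t : clear implicits.
Arguments LamP K t : clear implicits.
Arguments LamPbar K t : clear implicits.
Arguments LamPbarPred K t : clear implicits.

(* Main.v *)
Require Import Defs.
From HB Require Import structures.
From mathcomp Require Import all_boot all_order all_algebra fingroup perm.
From Stdlib Require Import Classical_Prop.
Set Implicit Arguments. Unset Strict Implicit. Unset Printing Implicit Defensive.
Import GRing.Theory.
Local Open Scope ring_scope.

(** In characteristic zero, [v] dies in the exterior power exactly when its
    antisymmetrisation [alt v] vanishes, so all quotients become conditions on
    antisymmetric tensors, and values on pure tensors are determinants.  Under
    [alt] the map [dMap] becomes contraction with the augmentation, and exactness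
    is the Koszul homotopy [b /\ -].  The functor [Lambda^t(P)] is generated by its
    value at [t], which is one-dimensional and on which [dMap] is injective; hence it
    is indecomposable and [dMap] is an essential epimorphism.  A nonzero element of
    [Lambda^s(Pbar)] can be pushed to a nonzero element over [s + 1] points, where
    this functor is also one-dimensional and generated, hence it is simple.
    Projectivity follows from Yoneda's lemma and averaging over the symmetric
    group. *)

(** * Antisymmetrisation, basis tensors and functoriality *)

(** Unnormalised, so that values on pure tensors are determinants with no factor $1/t!$. *)
Definition alt (K : fieldType) (t n : nat) (v : Vt K t n) : Vt K t n :=
  [ffun y : {ffun 'I_t -> 'I_n} =>
     \sum_(s : 'S_t) (-1) ^+ s * v [ffun i => y (s i)]].

Definition single (K : fieldType) (t n : nat) (x : {ffun 'I_t -> 'I_n}) : Vt K t n :=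
  [ffun y => (y == x)%:R].
Arguments single K {t n} x.

Lemma alt_is_linear K t n : linear (@alt K t n).
Proof.
move=> a u v; apply/ffunP => y; rewrite !ffunE scaler_sumr -big_split /=.
by apply: eq_bigr => s _; rewrite !ffunE mulrDr /GRing.scale /= mulrCA.
Qed.
HB.instance Definition _ (K : fieldType) (t n : nat) :=
  GRing.isLinear.Build K (Vt K t n) (Vt K t n) _ (@alt K t n) (@alt_is_linear K t n).

Lemma pushT_is_linear K t m n (f : {ffun 'I_m -> 'I_n}) : linear (@pushT K t m n f).
Proof.
move=> a u v; apply/ffunP => y; rewrite !ffunE scaler_sumr -big_split /=.
by apply: eq_bigr => s _; rewrite !ffunE.
Qed.
HB.instance Definition _ (K : fieldType) (t m n : nat) (f : {ffun 'I_m -> 'I_n}) :=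
  GRing.isLinear.Build K (Vt K t m) (Vt K t n) _ (@pushT K t m n f)
    (@pushT_is_linear K t m n f).

Lemma permV_is_linear K t n (s : 'S_t) : linear (@permV K t n s).
Proof. by move=> a u v; apply/ffunP => y; rewrite !ffunE. Qed.
HB.instance Definition _ (K : fieldType) (t n : nat) (s : 'S_t) :=
  GRing.isLinear.Build K (Vt K t n) (Vt K t n) _ (@permV K t n s)
    (@permV_is_linear K t n s).

Lemma Vt_sum_single K t n (v : Vt K t n) : v = \sum_x v x *: single K x.
Proof.
apply/ffunP => y; rewrite sum_ffunE (bigD1 y) //= !ffunE eqxx big1 ?addr0.
  by rewrite /GRing.scale /= mulr1.
move=> x /negPf xy; rewrite !ffunE eq_sym xy /GRing.scale /=; exact: mulr0.
Qed.

Lemma single_tens K t n (x : {ffun 'I_t -> 'I_n}) :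
  single K x = tens (fun i => delta1 K (x i)).
Proof.
apply/ffunP => y; rewrite !ffunE; case: eqP => [->|/eqP yx].
  by rewrite big1 // => i _; rewrite ffunE eqxx.
have [i yxi] : exists i, y i != x i.
  by apply/existsP; apply: contraR yx; rewrite negb_exists => /forallP yx;
     apply/eqP/ffunP => i; apply/eqP; move: (yx i); rewrite negbK.
by rewrite (bigD1 i) //= ffunE (negPf yxi) mul0r.
Qed.

Lemma pushT_single K t m n (f : {ffun 'I_m -> 'I_n}) (x : {ffun 'I_t -> 'I_m}) :
  pushT f (single K x) = single K (ffcomp f x).
Proof.
apply/ffunP => y; rewrite !ffunE big_mkcond (bigD1 x) //= big1 ?addr0 ?ffunE.
  by rewrite eqxx eq_sym; case: eqP.
by move=> z /negPf zx; rewrite ffunE zx; case: ifP.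
Qed.

Lemma ffcompA m n p q (h : {ffun 'I_p -> 'I_q}) (g : {ffun 'I_n -> 'I_p})
    (f : {ffun 'I_m -> 'I_n}) : ffcomp (ffcomp h g) f = ffcomp h (ffcomp g f).
Proof. by apply/ffunP => i; rewrite !ffunE. Qed.

Lemma ffcompf1 m n (f : {ffun 'I_m -> 'I_n}) : ffcomp f (ffid m) = f.
Proof. by apply/ffunP => i; rewrite !ffunE. Qed.

Lemma ffcomp1f m n (f : {ffun 'I_m -> 'I_n}) : ffcomp (ffid n) f = f.
Proof. by apply/ffunP => i; rewrite !ffunE. Qed.

Lemma pushT_id K t n (v : Vt K t n) : pushT (ffid n) v = v.
Proof.
rewrite [v]Vt_sum_single linear_sum; apply: eq_bigr => x _.
by rewrite linearZ /= pushT_single ffcomp1f.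
Qed.

Lemma pushT_comp K t m n p (f : {ffun 'I_m -> 'I_n}) (g : {ffun 'I_n -> 'I_p})
  (v : Vt K t m) : pushT (ffcomp g f) v = pushT g (pushT f v).
Proof.
rewrite [v]Vt_sum_single !linear_sum; apply: eq_bigr => x _.
by rewrite !linearZ /= !pushT_single ffcompA.
Qed.

Lemma alt_tens K t n (w : 'I_t -> Pn K n) (y : {ffun 'I_t -> 'I_n}) :
  alt (tens w) y = \det (\matrix_(i, j) w i (y j)).
Proof.
rewrite ffunE; apply: eq_bigr => s _; rewrite ffunE; congr (_ * _).
by apply: eq_bigr => i _; rewrite mxE ffunE.
Qed.

Lemma alt_single K t n (x y : {ffun 'I_t -> 'I_n}) :
  alt (single K x) y = \det (\matrix_(i, j) (y j == x i)%:R).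
Proof.
rewrite single_tens alt_tens; congr (\det _); apply/matrixP => i j.
by rewrite !mxE ffunE.
Qed.

Lemma alt_permV K t n (s : 'S_t) (v : Vt K t n) : alt (permV s v) = sgn K s *: alt v.
Proof.
apply/ffunP => y; rewrite !ffunE /sgn.
rewrite (reindex_inj (mulgI s)) /= [RHS]mulr_sumr; apply: eq_bigr => r _.
rewrite odd_permM signr_addb mulrA !ffunE; congr (_ * v _).
by apply/ffunP => i; rewrite !ffunE permM permKV.
Qed.

Lemma alt_sum_permV K t n (v : Vt K t n) : alt v = \sum_(s : 'S_t) sgn K s *: permV s v.
Proof.
apply/ffunP => y; rewrite ffunE sum_ffunE (reindex_inj invg_inj) /=.
by apply: eq_bigr => s _; rewrite !ffunE odd_permV.
Qed.

(** Place permutations act on the source of an index map and [f] on its target, so the two commute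
    on basis tensors. *)
Lemma alt_pushT K t m n (f : {ffun 'I_m -> 'I_n}) (v : Vt K t m) :
  alt (pushT f v) = pushT f (alt v).
Proof.
rewrite [v]Vt_sum_single !linear_sum; apply: eq_bigr => x _.
rewrite !linearZ /=; congr (_ *: _).
rewrite !alt_sum_permV linear_sum; apply: eq_bigr => s _; rewrite linearZ /=.
have permV_single p (z : {ffun 'I_t -> 'I_p}) :
    permV s (single K z) = single K [ffun i => z (s i)].
  apply/ffunP => y; rewrite !ffunE; congr (nat_of_bool _)%:R.
  apply/eqP/eqP => [<-|->]; apply/ffunP => i; rewrite !ffunE ?permK //.
  by rewrite permKV.
rewrite !(pushT_single, permV_single); congr (_ *: single K _).
by apply/ffunP => i; rewrite !ffunE.
Qed.

Lemma fact_neq0 (K : fieldType) (charK0 : [pchar K] =i pred0) t : t`!%:R != 0 :> K.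
Proof. by rewrite (proj1 (pcharf0P K) charK0) -lt0n fact_gt0. Qed.

Lemma alt_alt K t n (v : Vt K t n) : alt (alt v) = t`!%:R *: alt v.
Proof.
rewrite {1}[alt v]alt_sum_permV linear_sum /=.
under eq_bigr => s _ do rewrite linearZ /= alt_permV scalerA -signr_addb addbb scale1r.
by rewrite sumr_const card_Sn scaler_nat.
Qed.

(** Each generator is killed by [alt]. Conversely $\sum_s \mathrm{sgn}(s)(v.s - \mathrm{sgn}(s)v)$
    equals [alt v] minus $t!\,v$, so when [alt v] vanishes, dividing by $-t!$ writes $v$ in the
    span. *)
Lemma spanP_alternating (K : fieldType) (charK0 : [pchar K] =i pred0) t n
    (D : Vt K t n -> Prop) (v : Vt K t n) :
  subspaceP D -> (forall s u, D u -> D (permV s u)) ->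
  spanP (fun u => exists (s : 'S_t) (v : Vt K t n),
                    D v /\ u = permV s v - sgn K s *: v) v <-> D v /\ alt v = 0.
Proof.
move=> [D0 Dlin] Dperm; split=> [|[Dv av]].
  elim=> [|_ [s [w [Dw ->]]]|a x y _ [Dx ax] _ [Dy ay]].
  - by split=> //; rewrite linear0.
  - split; last by rewrite linearB linearZ /= alt_permV subrr.
    rewrite addrC -scaleNr; apply: Dlin => //; exact: Dperm.
  - by split; [exact: Dlin | rewrite linearP /= ax ay scaler0 addr0].
pose g := fun s : 'S_t => permV s v - sgn K s *: v.
have -> : v = \sum_(s : 'S_t) (- (t`!%:R)^-1 * sgn K s) *: g s.
  under eq_bigr => s _ do rewrite -scalerA scalerBr scalerA -signr_addb addbb scale1r.
  rewrite -scaler_sumr sumrB -alt_sum_permV av sub0r scalerN scaleNr opprK.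
  rewrite sumr_const card_Sn -[X in _ *: X]scaler_nat scalerA.
  by rewrite mulVf ?scale1r ?fact_neq0.
elim/big_ind: _ => [|x y ? ?|s _]; first exact: span0.
  by rewrite -[x]scale1r; apply: span_comb.
rewrite -[_ *: _]addr0; apply: span_comb; last exact: span0.
by apply: span_gen; exists s, v.
Qed.

(** * Contraction with the augmentation, and its relation to [dMap] *)

Definition consf (s n : nat) (a : 'I_n) (y : {ffun 'I_s -> 'I_n})
  : {ffun 'I_s.+1 -> 'I_n} :=
  [ffun i => if unlift ord0 i is Some j then y j else a].

(** The augmentation $[x]\mapsto 1$ applied to the first tensor factor. *)
Definition contr (K : fieldType) (s n : nat) (z : Vt K s.+1 n) : Vt K s n :=
  [ffun y => \sum_a z (consf a y)].

Lemma consf0 s n (a : 'I_n) (y : {ffun 'I_s -> 'I_n}) : consf a y ord0 = a.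
Proof. by rewrite ffunE unlift_none. Qed.

Lemma consf_lift s n (a : 'I_n) (y : {ffun 'I_s -> 'I_n}) i :
  consf a y (lift ord0 i) = y i.
Proof. by rewrite ffunE liftK. Qed.

Lemma contr_is_linear K s n : linear (@contr K s n).
Proof.
move=> a u v; apply/ffunP => y; rewrite !ffunE scaler_sumr -big_split /=.
by apply: eq_bigr => b _; rewrite !ffunE.
Qed.
HB.instance Definition _ (K : fieldType) (s n : nat) :=
  GRing.isLinear.Build K (Vt K s.+1 n) (Vt K s n) _ (@contr K s n)
    (@contr_is_linear K s n).

Definition augmx (K : fieldType) (s n : nat) (w : 'I_s.+1 -> Pn K n)
    (y : {ffun 'I_s -> 'I_n}) : 'M[K]_s.+1 :=
  \matrix_(i, j) if unlift ord0 j is Some k then w i (y k) else \sum_a w i a.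

(** A determinant is linear in its first column, so summing over the first argument replaces that
    column by the augmentations of the [w i]. *)
Lemma contr_alt_tens K s n (w : 'I_s.+1 -> Pn K n) (y : {ffun 'I_s -> 'I_n}) :
  contr (alt (tens w)) y = \det (augmx w y).
Proof.
rewrite ffunE (expand_det_col _ ord0).
under eq_bigr => a _ do rewrite alt_tens (expand_det_col _ ord0).
rewrite exchange_big /=; apply: eq_bigr => i _.
rewrite [augmx w y i ord0]mxE unlift_none mulr_suml; apply: eq_bigr => a _.
rewrite mxE consf0; congr (_ * (_ * \det _)); apply/matrixP => j k.
by rewrite !mxE consf_lift liftK.
Qed.

(* Subtracting the first row from the others turns the first column into
   (1, 0, ..., 0). *)
Lemma det_augmx K s n (w : 'I_s.+1 -> Pn K n) (y : {ffun 'I_s -> 'I_n}) :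
  (forall i, \sum_a w i a = 1) ->
  \det (augmx w y) = alt (tens (fun i => w (lift ord0 i) - w ord0)) y.
Proof.
move=> w1; pose L : 'M[K]_s.+1 :=
  \matrix_(i, j) ((i == j)%:R - ((j == ord0) && (i != ord0))%:R).
have detL : \det L = 1.
  rewrite det_trig; last first.
    apply/is_trig_mxP => i j ij; rewrite mxE.
    have /negPf -> : i != j by rewrite -val_eqE neq_ltn ij.
    have /negPf -> : j != ord0 by rewrite -val_eqE -lt0n (leq_ltn_trans _ ij).
    by rewrite subr0.
  by rewrite big1 // => i _; rewrite mxE eqxx andbN subr0.
have LA i j : (L *m augmx w y) i j
            = augmx w y i j - (i != ord0)%:R * augmx w y ord0 j.
  rewrite mxE; under eq_bigr => k _ do rewrite mxE mulrBl.
  rewrite sumrB (bigD1 i) //= eqxx mul1r big1 ?addr0; last first.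
    by move=> k /negPf ki; rewrite eq_sym ki mul0r.
  rewrite (bigD1 ord0) //= big1 ?addr0 //.
  by move=> k /negPf ki; rewrite ki mul0r.
rewrite -[LHS]mul1r -detL -det_mulmx (expand_det_col _ ord0) big_ord_recl big1.
  rewrite addr0 LA eqxx mul0r subr0 mxE unlift_none w1 mul1r /cofactor expr0 mul1r.
  rewrite alt_tens; congr (\det _); apply/matrixP => i j.
  by rewrite mxE mxE LA !mxE liftK /= mul1r !ffunE.
by move=> i _; rewrite LA mul1r !mxE unlift_none !w1 subrr mul0r.
Qed.

Lemma sum_delta1 K n (a : 'I_n) : \sum_b delta1 K a b = 1.
Proof.
rewrite (bigD1 a) //= ffunE eqxx big1 ?addr0 // => b /negPf ba.
by rewrite ffunE ba.
Qed.

(** [dMap] in positive degree, retyped between the spaces [Vt] so that it can carry a linear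
    structure. *)
Definition koszul (K : fieldType) (s n : nat) (v : Vt K s.+1 n) : Vt K s n :=
  dMap K s.+1 n v.

Lemma koszul_is_linear K s n : linear (@koszul K s n).
Proof.
move=> a u v; rewrite /koszul /dMap scaler_sumr -big_split; apply: eq_bigr => x _.
by rewrite !ffunE scalerDl scalerA.
Qed.
HB.instance Definition _ (K : fieldType) (s n : nat) :=
  GRing.isLinear.Build K (Vt K s.+1 n) (Vt K s n) _ (@koszul K s n)
    (@koszul_is_linear K s n).

Lemma koszul_single K s n (x : {ffun 'I_s.+1 -> 'I_n}) :
  koszul (single K x) =
  tens (fun i : 'I_s => delta1 K (x (lift ord0 i)) - delta1 K (x ord0)).
Proof.
rewrite /koszul /dMap (bigD1 x) //= ffunE eqxx scale1r big1 ?addr0 // => z /negPf zx.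
by rewrite ffunE zx scale0r.
Qed.

Lemma koszul_sum K s n (v : Vt K s.+1 n) :
  koszul v = \sum_x v x *: koszul (single K x).
Proof. by apply: eq_bigr => x _; rewrite koszul_single. Qed.

(** By linearity it suffices to treat basis tensors; their factors have augmentation 1, so the row
    reduction of [det_augmx] applies. *)
Lemma alt_koszul K s n (v : Vt K s.+1 n) : alt (koszul v) = contr (alt v).
Proof.
rewrite [v]Vt_sum_single [koszul _]linear_sum !linear_sum; apply: eq_bigr => x _.
rewrite !linearZ /=; congr (_ *: _); apply/ffunP => y.
rewrite koszul_single single_tens contr_alt_tens det_augmx // => i.
exact: sum_delta1.
Qed.

Lemma pushT_tens K t m n (f : {ffun 'I_m -> 'I_n}) (w : 'I_t -> Pn K m) :
  pushT f (tens w) = tens (fun i => [ffun b => \sum_(a | f a == b) w i a]).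
Proof.
apply/ffunP => y; rewrite !ffunE.
under [RHS]eq_bigr => i _ do rewrite ffunE.
rewrite bigA_distr_big_dep /=; apply: eq_big => [x|x _]; last by rewrite ffunE.
apply/eqP/forallP => [<- i|fx]; first by rewrite unfold_in ffunE.
by apply/ffunP => i; move: (fx i); rewrite unfold_in ffunE => /eqP.
Qed.

Lemma koszul_pushT K s m n (f : {ffun 'I_m -> 'I_n}) (v : Vt K s.+1 m) :
  koszul (pushT f v) = pushT f (koszul v).
Proof.
rewrite [v]Vt_sum_single [koszul (\sum_i _)]linear_sum !linear_sum; apply: eq_bigr => x _.
rewrite !linearZ /= pushT_single; congr (_ *: _).
rewrite !koszul_single pushT_tens; apply/ffunP => y; rewrite !ffunE.
apply: eq_bigr => i _; rewrite !ffunE.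
under eq_bigr => a _ do rewrite !ffunE.
have sumd c : \sum_(a | f a == y i) (a == c)%:R = (y i == f c)%:R :> K.
  rewrite big_mkcond (bigD1 c) //= big1 ?addr0; first by rewrite eqxx eq_sym; case: eqP.
  by move=> a /negPf ac; rewrite ac; case: ifP.
by rewrite sumrB !sumd.
Qed.

(** * The Koszul homotopy *)

Definition wedge (K : fieldType) (t n : nat) (b : 'I_n) (v : Vt K t n) : Vt K t.+1 n :=
  \sum_x v x *: single K (consf b x).

(** On basis tensors this is the expansion of the determinant along the row of the new factor
    $[b]$. *)
Lemma alt_wedge K t n (b : 'I_n) (v : Vt K t n) (y : {ffun 'I_t.+1 -> 'I_n}) :
  alt (wedge b v) y =
  \sum_(j < t.+1) (-1) ^+ j * (y j == b)%:R * alt v [ffun i => y (lift j i)].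
Proof.
rewrite /wedge linear_sum sum_ffunE.
under [RHS]eq_bigr => j _ do
  rewrite [in X in alt X](Vt_sum_single v) linear_sum sum_ffunE mulr_sumr.
rewrite exchange_big /=; apply: eq_bigr => x _.
rewrite linearZ ffunE /= alt_single (expand_det_row _ ord0) [LHS]mulr_sumr.
apply: eq_bigr => j _; rewrite linearZ ffunE /= alt_single mxE consf0 /cofactor add0n.
rewrite [RHS]mulrCA; congr (_ * _); rewrite [RHS]mulrAC mulrC.
congr (_ * \det _ * _); apply/matrixP => i k; by rewrite !mxE consf_lift ffunE.
Qed.

(* The Koszul homotopy: b /\ - is a right inverse of contraction on cycles. *)
Lemma contr_alt_wedge0 K n (b : 'I_n) (v : Vt K 0 n) : contr (alt (wedge b v)) = alt v.
Proof.
apply/ffunP => y; rewrite ffunE (bigD1 b) //= alt_wedge big_ord1 consf0 eqxx big1 ?addr0.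
  by rewrite !mul1r; congr (alt v _); apply/ffunP => -[].
by move=> a /negPf ab; rewrite alt_wedge big_ord1 consf0 ab mulr0 mul0r.
Qed.

Lemma contr_alt_wedge K s n (b : 'I_n) (v : Vt K s.+1 n) :
  contr (alt v) = 0 -> contr (alt (wedge b v)) = alt v.
Proof.
move=> cv; apply/ffunP => y; rewrite ffunE.
under eq_bigr => a _ do rewrite alt_wedge big_ord_recl consf0.
rewrite big_split /= [X in _ + X]exchange_big [X in _ + X]big1 /= ?addr0.
  rewrite (bigD1 b) //= eqxx big1 ?addr0 => [|a /negPf ab].
    rewrite !mul1r; congr (alt v _); apply/ffunP => i.
    by rewrite ffunE consf_lift.
  by rewrite ab mulr0 mul0r.
(* Only the leading term of the expansion survives. In the others, summing over [a] gives
   [contr (alt v)] at [y] with its [k]-th entry removed, which is zero. *)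
move=> k _; under eq_bigr => a _ do rewrite consf_lift.
rewrite -mulr_sumr.
have := congr1 (fun z : Vt K s n => z [ffun i => y (lift k i)]) cv.
rewrite /= !ffunE => cvk.
rewrite (_ : \sum_a _ = 0) ?mulr0 // -[RHS]cvk; apply: eq_bigr => a _.
congr (alt v _); apply/ffunP => i; rewrite [LHS]ffunE.
case: (unliftP ord0 i) => [j ->|->].
  rewrite consf_lift [RHS]ffunE.
  rewrite (_ : lift (lift ord0 k) (lift ord0 j) = lift ord0 (lift k j)) ?consf_lift //.
  by apply: val_inj; rewrite /= /bump /= ltnS addnS.
rewrite consf0 (_ : lift (lift ord0 k) ord0 = ord0) ?consf0 //; exact: val_inj.
Qed.

(** * Subspaces and the tensor powers of $\overline P$ *)

Lemma subspaceD (K : fieldType) (V : lmodType K) (S : V -> Prop) x y :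
  subspaceP S -> S x -> S y -> S (x + y).
Proof. by move=> [_ Sl] Sx Sy; rewrite -[x]scale1r; apply: Sl. Qed.

Lemma subspaceZ (K : fieldType) (V : lmodType K) (S : V -> Prop) (a : K) x :
  subspaceP S -> S x -> S (a *: x).
Proof. by move=> [S0 Sl] Sx; rewrite -[_ *: _]addr0; apply: Sl. Qed.

Lemma subspaceB (K : fieldType) (V : lmodType K) (S : V -> Prop) x y :
  subspaceP S -> S x -> S y -> S (x - y).
Proof. by move=> HS Sx Sy; rewrite -scaleN1r; apply: subspaceD => //; apply: subspaceZ. Qed.

Lemma subspace_sum (K : fieldType) (V : lmodType K) (S : V -> Prop) (I : finType)
    (F : I -> V) : subspaceP S -> (forall i, S (F i)) -> S (\sum_i F i).
Proof.
move=> HS SF; elim/big_ind: _ => [|x y|i _] //; first by case: HS.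
exact: subspaceD.
Qed.

Lemma spanP_subspace (K : fieldType) (V : lmodType K) (S : V -> Prop) :
  subspaceP (spanP S).
Proof. by split=> [|a x y]; [exact: span0 | exact: span_comb]. Qed.

Lemma spanP_mono (K : fieldType) (V W : lmodType K) (phi : {linear V -> W})
    (S : V -> Prop) (T : W -> Prop) v :
  (forall x, S x -> T (phi x)) -> spanP S v -> spanP T (phi v).
Proof.
move=> ST; elim=> [|x /ST|a x y _ ? _ ?]; first by rewrite linear0; exact: span0.
  exact: span_gen.
by rewrite linearP; apply: span_comb.
Qed.

Lemma PbarT_subspace K t n : subspaceP (@PbarT K t n).
Proof.
rewrite /PbarT; case: eqP => _; last exact: spanP_subspace.
split=> [|a x y [?|->] [?|->]]; [by right | by left | by left | by left |].
by right; rewrite scaler0 addr0.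
Qed.

Lemma Vt_empty K t (v : Vt K t.+1 0) : v = 0.
Proof. by apply/ffunP => y; case: (y ord0). Qed.

Lemma PbarT_permV K t n (s : 'S_t) (v : Vt K t n) : PbarT v -> PbarT (permV s v).
Proof.
rewrite /PbarT; case: eqP => _; first by case=> [|->]; [left|right; rewrite linear0].
apply: spanP_mono => _ [w [w0 ->]]; exists (fun i => w (s i)); split=> //.
apply/ffunP => y; rewrite !ffunE (reindex_inj (@perm_inj _ s)) /=.
by apply: eq_bigr => i _; rewrite ffunE permK.
Qed.

Lemma PbarT_pushT K t m n (f : {ffun 'I_m -> 'I_n}) (v : Vt K t m) :
  PbarT v -> PbarT (pushT f v).
Proof.
rewrite /PbarT; case: eqP => _.
  case=> [|->]; last by right; rewrite linear0.
  by case: m f v => // m f v _; left; exact: leq_ltn_trans (ltn_ord (f ord0)).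
apply: spanP_mono => _ [w [w0 ->]] /=; rewrite pushT_tens; eexists; split; last by [].
move=> i; rewrite /inPbar -[RHS](w0 i) (partition_big f xpredT) //=.
by apply: eq_bigr => b _; rewrite ffunE.
Qed.

(** A difference of two basis vectors has augmentation zero. The case [s = 0] is separate because
    the zeroth power is $\overline\Bbbk$ by convention. *)
Lemma PbarT_koszul K s n (v : Vt K s.+1 n) : PbarT (koszul v).
Proof.
case: n v => [|n] v; first by rewrite [v]Vt_empty linear0; case: (PbarT_subspace K s 0).
case: s v => [|s] v; first by left.
rewrite koszul_sum; apply: subspace_sum => [|x]; first exact: PbarT_subspace.
apply: subspaceZ; first exact: PbarT_subspace.
rewrite koszul_single; apply: span_gen; eexists; split; last by [].
move=> i; rewrite /inPbar; under eq_bigr => b _ do rewrite ffunE [X in _ + X]ffunE.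
by rewrite sumrB !sum_delta1 subrr.
Qed.

(** If all factors have augmentation zero, the first column of [augmx] vanishes. *)
Lemma contr_alt_PbarT K s n (v : Vt K s.+1 n) : PbarT v -> contr (alt v) = 0.
Proof.
elim=> [|_ [w [w0 ->]]|a x y _ IHx _ IHy]; first by rewrite !linear0.
  apply/ffunP => y; rewrite contr_alt_tens (expand_det_col _ ord0) big1 ?ffunE //.
  by move=> i _; rewrite mxE unlift_none w0 mul0r.
by rewrite !linearP /= IHx IHy scaler0 addr0.
Qed.

Lemma alt_koszul_wedge K s n (b : 'I_n) (v : Vt K s n) :
  PbarT v -> alt (koszul (wedge b v)) = alt v.
Proof.
rewrite alt_koszul; case: s v => [|s] v Pv; first exact: contr_alt_wedge0.
by rewrite contr_alt_wedge // contr_alt_PbarT.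
Qed.

(** * Null spaces, modules and morphisms *)

Lemma LamOf_null (K : fieldType) (charK0 : [pchar K] =i pred0) t
    (D : forall n, Vt K t n -> Prop) n (v : Vt K t n) :
  subspaceP (D n) -> (forall (s : 'S_t) u, D n u -> D n (permV s u)) ->
  Fnull (LamOf D) n v <-> D n v /\ alt v = 0.
Proof. exact: spanP_alternating. Qed.

Lemma LamP_null (K : fieldType) (charK0 : [pchar K] =i pred0) t n (v : Vt K t n) :
  Fnull (LamP K t) n v <-> alt v = 0.
Proof. by rewrite LamOf_null //; split=> // -[]. Qed.

Lemma LamPbar_null (K : fieldType) (charK0 : [pchar K] =i pred0) t n (v : Vt K t n) :
  Fnull (LamPbar K t) n v <-> PbarT v /\ alt v = 0.
Proof. by rewrite LamOf_null //; [exact: PbarT_subspace | move=> s u; exact: PbarT_permV]. Qed.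

Lemma LamOf_isFAmod (K : fieldType) (charK0 : [pchar K] =i pred0) t
    (D : forall n, Vt K t n -> Prop) :
  (forall n, subspaceP (D n)) -> (forall n (s : 'S_t) u, D n u -> D n (permV s u)) ->
  (forall m n (f : {ffun 'I_m -> 'I_n}) u, D m u -> D n (pushT f u)) ->
  isFAmod (LamOf D).
Proof.
move=> Dsub Dperm Dpush; have null n v := LamOf_null charK0 v (Dsub n) (@Dperm n).
have null0 n : Fnull (LamOf D) n 0 by exact: span0.
split=> //; split; first by move=> n; exact: spanP_subspace.
split; first by move=> n x /null[].
split; first by move=> m n f x; exact: Dpush.
split; first by move=> m n f x /null[Dx ax]; apply/null; split;
  [exact: Dpush | rewrite /= alt_pushT ax linear0].
split; first by move=> m n f a x y _ _; rewrite /= linearP subrr; exact: null0.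
split; first by move=> n x _; rewrite /= pushT_id subrr; exact: null0.
by move=> m n p f g x _; rewrite /= pushT_comp subrr; exact: null0.
Qed.

Lemma LamP_isFAmod (K : fieldType) (charK0 : [pchar K] =i pred0) t : isFAmod (LamP K t).
Proof. exact: LamOf_isFAmod. Qed.

Lemma LamPbar_isFAmod (K : fieldType) (charK0 : [pchar K] =i pred0) t :
  isFAmod (LamPbar K t).
Proof.
apply: LamOf_isFAmod => // [n|n s u|m n f u].
- exact: PbarT_subspace.
- exact: PbarT_permV.
- exact: PbarT_pushT.
Qed.

Lemma Kzero_isFAmod (K : fieldType) : isFAmod (Kzero K).
Proof.
have null0 n : Fnull (Kzero K) n 0 by right.
split=> //.
split; first by move=> n; exact: (PbarT_subspace K 0 n).
split=> //.
split=> //.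
split; first by move=> m n f x; exact: (@PbarT_pushT K 0 m n f x).
split; first by move=> m n f a x y _ _; rewrite /= linearP subrr; exact: null0.
split; first by move=> n x _; rewrite /= pushT_id subrr; exact: null0.
by move=> m n p f g x _; rewrite /= pushT_comp subrr; exact: null0.
Qed.

Lemma LamPbarPred_isFAmod (K : fieldType) (charK0 : [pchar K] =i pred0) t :
  isFAmod (LamPbarPred K t).
Proof. by case: t => [|s]; [exact: Kzero_isFAmod | exact: LamPbar_isFAmod]. Qed.

Lemma inclMap_isHom (K : fieldType) (charK0 : [pchar K] =i pred0) t :
  isHom (inclMap K t).
Proof.
split=> //; split; first by move=> n x /(LamPbar_null charK0)[_ ax]; apply/LamP_null.
by split=> [n a x y _ _|m n f x _]; rewrite /inclMap subrr; exact: span0.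
Qed.

Lemma dMap_isHom (K : fieldType) (charK0 : [pchar K] =i pred0) t : isHom (dMap K t).
Proof.
case: t => [|s].
  split=> //; split.
    (* In degree zero the symmetric group is trivial, so [alt] is the identity. *)
    move=> n x /(LamP_null charK0) ax; right; rewrite -[RHS]ax; apply/ffunP => y.
    rewrite ffunE (bigD1 1%g) //= odd_perm1 mul1r big1 ?addr0.
      by congr (x _); apply/ffunP => -[].
    by move=> r /eqP[]; apply/permP => -[].
  by split=> [n a x y _ _|m n f x _]; right; rewrite subrr.
split; first by move=> n x _; exact: PbarT_koszul.
split.
  move=> n x /(LamP_null charK0) ax; apply/LamPbar_null => //; split.
    exact: PbarT_koszul.
  by rewrite -/(koszul _) alt_koszul ax linear0.
split=> [n a x y _ _|m n f x _].
  change (Fnull (LamPbar K s) n (koszul (a *: x + y) - (a *: koszul x + koszul y))).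
  by rewrite koszul_is_linear subrr; exact: span0.
change (Fnull (LamPbar K s) n (koszul (pushT f x) - pushT f (koszul x))).
by rewrite koszul_pushT subrr; exact: span0.
Qed.

(** * Exactness of the sequence *)

Lemma dMap_hsurj (K : fieldType) (charK0 : [pchar K] =i pred0) t : hsurj (dMap K t).
Proof.
case: t => [|s] n y Dy; first by exists y; split=> //; right; rewrite subrr.
case: n y Dy => [|n] y Dy.
  (* The empty set offers no point to wedge with, but there the target is zero. *)
  exists 0; split=> //.
  have -> : dMap K s.+1 0%N 0 = 0 :> Vt K s 0 by exact: (linear0 (@koszul K s 0)).
  have -> : y = 0 by case: s y Dy => [|s] y; [case | move=> _; exact: Vt_empty].
  by rewrite subrr; exact: span0.
exists (wedge ord0 y); split=> //; apply/LamPbar_null => //; split.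
  by apply: subspaceB => //; [exact: PbarT_subspace | exact: PbarT_koszul].
by rewrite -/(koszul _) linearB /= alt_koszul_wedge // subrr.
Qed.

Lemma LamP_SES (K : fieldType) (charK0 : [pchar K] =i pred0) t :
  isSES (inclMap K t) (dMap K t).
Proof.
split; first by move=> n x Dx /(LamP_null charK0) ax; apply/LamPbar_null.
split; last exact: dMap_hsurj.
case: t => [|s] n y _.
  split=> [Dy|[x [Dx]]]; first by exists y; split=> //; rewrite subrr; exact: span0.
  case: (dMap_isHom charK0 0) => _ [H _] /H [|/eqP]; first by left.
  by rewrite subr_eq0 => /eqP <-.
split.
  move=> /(LamPbar_null charK0)[_]; rewrite -/(koszul _) alt_koszul => cy.
  case: n y cy => [|n] y cy.
    exists 0; split; first by case: (PbarT_subspace K s.+1 0).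
    by rewrite [y]Vt_empty subrr; exact: span0.
  (* The homotopy represents the cycle [y] by a boundary, and boundaries lie in the tensor power of
     $\overline P$. *)
  exists (koszul (wedge ord0 y)); split; first exact: PbarT_koszul.
  by apply/LamP_null => //; rewrite linearB /= alt_koszul contr_alt_wedge // subrr.
move=> [x [Dx /(LamP_null charK0)]]; rewrite linearB => /eqP; rewrite subr_eq0 => /eqP xy.
apply/LamPbar_null => //; split; first exact: PbarT_koszul.
by rewrite -/(koszul _) alt_koszul -xy contr_alt_PbarT.
Qed.

(** * One-dimensional values and generation *)

(** On $t$ points the incidence matrix of [x] and [y] is the product of those of [x] and of [y], and
    determinants are multiplicative. *)
Lemma alt_single_top K t (x : {ffun 'I_t -> 'I_t}) :
  alt (single K x) = \det (\matrix_(i, j) (j == x i)%:R) *: alt (single K (ffid t)).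
Proof.
apply/ffunP => y; rewrite [RHS]ffunE !alt_single -[RHS]det_mulmx; congr (\det _).
apply/matrixP => i j; rewrite !mxE (bigD1 (x i)) //= big1 ?addr0.
  by rewrite !mxE ffunE eqxx mul1r.
by move=> k /negPf kx; rewrite !mxE kx mul0r.
Qed.

Lemma alt_top K t (v : Vt K t t) : exists k, alt v = k *: alt (single K (ffid t)).
Proof.
exists (\sum_x v x * \det (\matrix_(i, j) (j == x i)%:R)).
rewrite {1}[v]Vt_sum_single linear_sum scaler_suml; apply: eq_bigr => x _.
by rewrite linearZ /= alt_single_top scalerA.
Qed.

Lemma alt_single_id_neq0 K t : alt (single K (ffid t)) != 0.
Proof.
apply/eqP => /(congr1 (fun z : Vt K t t => z (ffid t))); rewrite alt_single ffunE.
rewrite (_ : \matrix_(i, j) _ = 1%:M) ?det1; first by move/eqP; rewrite oner_eq0.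
by apply/matrixP => i j; rewrite !mxE !ffunE eq_sym.
Qed.

Lemma alt_koszul_single_id_neq0 K s : alt (koszul (single K (ffid s.+1))) != 0.
Proof.
(* At the tuple of all points except the base point, the summand $-[0]$ of each factor contributes
   nothing and the matrix is the identity. *)
apply/eqP => /(congr1 (fun z : Vt K s s.+1 => z [ffun j => lift ord0 j])).
rewrite koszul_single alt_tens [X in _ = X]ffunE.
rewrite (_ : \matrix_(i, j) _ = 1%:M) ?det1; first by move/eqP; rewrite oner_eq0.
apply/matrixP => i j; rewrite !mxE !ffunE (inj_eq lift_inj) eq_sym.
by rewrite -[lift _ _ == ord0]eq_sym (negPf (neq_lift _ _)) subr0.
Qed.

Lemma alt_eq0 K t n (v : Vt K t n) (y : {ffun 'I_t -> 'I_n}) i j :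
  i != j -> y i = y j -> alt v y = 0.
Proof.
move=> ij yij; rewrite [v]Vt_sum_single linear_sum sum_ffunE big1 // => x _.
rewrite linearZ ffunE /= alt_single -det_tr (determinant_alternate ij) ?[LHS]mulr0 //.
by move=> k; rewrite !mxE yij.
Qed.

Lemma Vt_neq0P K t n (v : Vt K t n) : v != 0 -> exists y, v y != 0.
Proof.
move=> v0; apply/existsP; apply: contraR v0; rewrite negb_exists => /forallP v0.
by apply/eqP/ffunP => y; move: (v0 y); rewrite negbK ffunE => /eqP.
Qed.

(** A tuple [y] with [alt v y] nonzero is injective. Let [f] number its entries and collapse all
    other points to the extra point [ord0]; then [y] is the only tuple pushed to the numbering, so
    the value there is [alt v y]. *)
Lemma pushT_to_top K s n (v : Vt K s n) :
  alt v != 0 -> exists f : {ffun 'I_n -> 'I_s.+1}, alt (pushT f v) != 0.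
Proof.
move=> av; have [y vy] := Vt_neq0P av.
have y_inj : injective y.
  move=> i j yij; apply/eqP; apply: contraNT vy => ij; apply/eqP.
  exact: alt_eq0 yij.
pose f : {ffun 'I_n -> 'I_s.+1} :=
  [ffun a => if [pick j | y j == a] is Some j then lift ord0 j else ord0].
exists f; rewrite alt_pushT; apply: contraNneq vy.
move/(congr1 (fun z : Vt K s s.+1 => z [ffun j => lift ord0 j])).
rewrite [X in X = _]ffunE [X in _ = X]ffunE.
rewrite (bigD1 y) /= ?big1 ?addr0 => [->//|z /andP[/eqP fz /eqP[]]|].
  apply/ffunP => j; have := congr1 (fun h : {ffun 'I_s -> 'I_s.+1} => h j) fz.
  rewrite /= !ffunE; case: pickP => [k /eqP <- /lift_inj -> //|_ /eqP].
  by rewrite (negPf (neq_lift _ _)).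
apply/eqP/ffunP => j; rewrite !ffunE; case: pickP => [k /eqP/y_inj -> //|/(_ j)].
by rewrite eqxx.
Qed.

Lemma pushT_single_id K t n (x : {ffun 'I_t -> 'I_n}) :
  pushT x (single K (ffid t)) = single K x.
Proof. by rewrite pushT_single ffcompf1. Qed.

(** Every basis tensor is the pushforward of the identity tuple. *)
Lemma LamP_generated (K : fieldType) t S :
  isSubmod (LamP K t) S -> S t (single K (ffid t)) -> forall n v, S n v.
Proof.
move=> [Ssub [_ [_ Sact]]] Sid n v; rewrite (Vt_sum_single v).
apply: (subspace_sum (Ssub n)) => x; apply: (subspaceZ _ (Ssub n)).
by rewrite -pushT_single_id; apply: Sact.
Qed.

(** Up to null elements, [dMap] maps the generated module $\Lambda^{s+1}(P)$ onto this one, so the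
    image of the generator generates. *)
Lemma LamPbar_generated (K : fieldType) (charK0 : [pchar K] =i pred0) s S :
  isSubmod (LamPbar K s) S -> S s.+1 (koszul (single K (ffid s.+1))) ->
  forall n v, PbarT v -> S n v.
Proof.
move=> [Ssub [_ [Snull Sact]]] Sid n v Pv.
have [x [_ /Snull]] := dMap_hsurj charK0 (t := s.+1) (y := v : FV (LamPbarPred K s.+1) n) Pv.
rewrite -/(koszul _) => Sxv; rewrite -[v](subKr (koszul x)).
apply: (subspaceB (Ssub n)) => //; rewrite koszul_sum.
apply: (subspace_sum (Ssub n)) => z; apply: (subspaceZ _ (Ssub n)).
by rewrite -pushT_single_id koszul_pushT; apply: Sact.
Qed.

(** * Simplicity and indecomposability *)

Lemma Kzero_isSimple (K : fieldType) : isSimple (Kzero K).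
Proof.
split=> [/(_ 0 (single K (ffid 0)) I)[] //|].
  by move/eqP; apply/negP; apply: contra (alt_single_id_neq0 K 0) => /eqP ->; rewrite linear0.
move=> S [Ssub [_ [Snull _]]].
have [[x [Sx x0]]|S0] := classic (exists x, S 0 x /\ x <> 0 :> Vt K 0 0); [right|left].
  move=> n v _; case: n v => [|n] v; last by apply: Snull; left.
  have [y xy] := Vt_neq0P (introN eqP x0).
  rewrite (_ : v = (v y / x y) *: (x : Vt K 0 0)); first exact: (subspaceZ _ (Ssub 0)).
  apply/ffunP => z; rewrite (_ : z = y); last by apply/ffunP => -[].
  by rewrite ffunE /GRing.scale /= divfK.
move=> n x Sx; case: n x Sx => [|n] x Sx; last by left.
by right; apply: NNPP => x0; apply: S0; exists x.
Qed.

Lemma LamPbar_isSimple (K : fieldType) (charK0 : [pchar K] =i pred0) s :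
  isSimple (LamPbar K s).
Proof.
set e0 := koszul (single K (ffid s.+1)); have Pe0 : PbarT e0 by exact: PbarT_koszul.
split=> [/(_ s.+1 e0 Pe0)/(LamPbar_null charK0)[_ /eqP]|S Smod].
  by apply/negP/alt_koszul_single_id_neq0.
have [Ssub [Sdom [Snull Sact]]] := Smod.
have [[n [x [Sx ax]]]|S0] := classic (exists n (x : Vt K s n), S n x /\ alt x != 0);
  last first.
  left=> n x Sx; apply/LamPbar_null => //; split; first exact: Sdom Sx.
  by apply/eqP; apply/negPn/negP => ax; apply: S0; exists n, x.
right; apply: LamPbar_generated => //.
have [f] := pushT_to_top ax.
have: S s.+1 (pushT f x) by exact: Sact.
move: (pushT f x) => u Su au; have Pu : PbarT u := Sdom _ _ Su.
(* The homotopy lifts [u] to $\Lambda^{s+1}(P)$ over $s+1$ points, which is a line; contracting back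
   compares [u] with [e0]. *)
have [k uk] : exists k, alt u = k *: alt e0.
  rewrite -(alt_koszul_wedge ord0 Pu) !alt_koszul.
  by have [k ->] := alt_top (wedge ord0 u); exists k; rewrite linearZ.
have k0 : k != 0 by apply: contraNneq au => k0; rewrite uk k0 scale0r.
rewrite -/e0 -[e0](subKr (k^-1 *: u)); apply: (subspaceB (Ssub _)).
  exact: (subspaceZ _ (Ssub _)).
apply: Snull; apply/LamPbar_null => //; split.
  apply: subspaceB => //; first exact: PbarT_subspace.
  by apply: subspaceZ => //; exact: PbarT_subspace.
by rewrite linearB linearZ /= uk scalerA mulVf // scale1r subrr.
Qed.

Lemma LamPbarPred_isSimple (K : fieldType) (charK0 : [pchar K] =i pred0) t :
  isSimple (LamPbarPred K t).
Proof. by case: t => [|s]; [exact: Kzero_isSimple | exact: LamPbar_isSimple]. Qed.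

Lemma LamP_isIndecomposable (K : fieldType) (charK0 : [pchar K] =i pred0) t :
  isIndecomposable (LamP K t).
Proof.
set e := single K (ffid t).
split=> [/(_ t e I)/(LamP_null charK0)/eqP|]; first by apply/negP/alt_single_id_neq0.
move=> S1 S2 S1mod S2mod S12 /(_ t e I)[y [z [Sy [Sz /(LamP_null charK0)]]]].
have gen S (Smod : isSubmod (LamP K t) S) (u : Vt K t t) :
    S t u -> alt u = alt e -> forall n v, S n v.
  move=> Su ue; apply: LamP_generated => //; have [Ssub [_ [Snull _]]] := Smod.
  rewrite -/e -[e](subKr u); apply: (subspaceB (Ssub _)) => //; apply: Snull.
  by apply/LamP_null => //; rewrite linearB /= ue subrr.
(* Split the generator as [y + z]. If the coefficient [k] of [y] is zero, then [z] represents the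
   generator and [S2] is everything; otherwise a multiple of [y] does and [S1] is everything. The
   other summand then lies in the null intersection. *)
have [k yk] := alt_top (y : Vt K t t).
rewrite linearB => /eqP; rewrite subr_eq0 => /eqP eyz.
have [k0|k0] := eqVneq k 0; [left|right] => n x Sx; apply: S12 => //.
  by apply: (gen _ S2mod z) => //; rewrite eyz linearD /= yk k0 scale0r add0r.
have [S1sub _] := S1mod.
apply: (gen _ S1mod (k^-1 *: (y : Vt K t t))); first exact: (subspaceZ _ (S1sub _)).
by rewrite linearZ /= yk scalerA mulVf // scale1r.
Qed.

(** * Maps that are linear only modulo a subspace *)

Lemma subspace_trans (K : fieldType) (V : lmodType K) (N : V -> Prop) y x z :
  subspaceP N -> N (x - y) -> N (y - z) -> N (x - z).
Proof. by move=> HN xy yz; rewrite -[x](subrK y) -addrA; apply: subspaceD. Qed.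

Lemma subspace_sum_sub (K : fieldType) (V : lmodType K) (N : V -> Prop) (I : finType)
    (c : I -> K) (F G : I -> V) :
  subspaceP N -> (forall i, N (F i - G i)) ->
  N (\sum_i c i *: F i - \sum_i c i *: G i).
Proof.
move=> HN FG; rewrite -sumrB; apply: subspace_sum => // i.
by rewrite -scalerBr; apply: subspaceZ.
Qed.

Section LinearModulo.
Variables (K : fieldType) (V W : lmodType K) (D : V -> Prop) (N : W -> Prop).
Variable phi : V -> W.
Hypotheses (Dsub : subspaceP D) (Nsub : subspaceP N).
Hypothesis phi_lin : forall a x y, D x -> D y ->
  N (phi (a *: x + y) - (a *: phi x + phi y)).

Lemma linear_modulo0 : N (phi 0).
Proof.
have [D0 _] := Dsub; have := phi_lin 1 D0 D0.
rewrite !scale1r addr0 opprD addrA subrr sub0r => /(subspaceZ (-1) Nsub).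
by rewrite scaleN1r opprK.
Qed.

Lemma linear_moduloB x y : D x -> D y -> N (phi (x - y)) -> N (phi x - phi y).
Proof.
move=> Dx Dy Nxy; have := phi_lin (-1) Dy Dx; rewrite !scaleN1r ![- _ + _]addrC.
by move=> /(subspaceB Nsub Nxy); rewrite subKr.
Qed.

Lemma linear_modulo_sum (I : finType) (c : I -> K) (F : I -> V) :
  (forall i, D (F i)) -> N (phi (\sum_i c i *: F i) - \sum_i c i *: phi (F i)).
Proof.
move=> DF; have [D0 Dlin] := Dsub.
suff: D (\sum_i c i *: F i) /\ N (phi (\sum_i c i *: F i) - \sum_i c i *: phi (F i)) by case.
elim/big_rec2: _ => [|i y x _ [Dx Nxy]].
  by rewrite subr0; split=> //; exact: linear_modulo0.
split; first exact: Dlin.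
apply: (subspace_trans (y := c i *: phi (F i) + phi x)) => //; first exact: phi_lin.
by rewrite opprD addrACA subrr add0r.
Qed.
End LinearModulo.

(** * Projectivity *)

Lemma sum_pushT (K : fieldType) (V : lmodType K) t m n (f : {ffun 'I_m -> 'I_n})
    (w : Vt K t m) (G : {ffun 'I_t -> 'I_n} -> V) :
  \sum_y pushT f w y *: G y = \sum_x w x *: G (ffcomp f x).
Proof.
rewrite [RHS](partition_big (ffcomp f) xpredT) //=; apply: eq_bigr => y _.
by rewrite ffunE scaler_suml; apply: eq_bigr => x /eqP ->.
Qed.

(* Yoneda lifts the value at the generator; averaging over the symmetric group
   makes the lift vanish on the null space. *)
Lemma LamP_isProjective (K : fieldType) (charK0 : [pchar K] =i pred0) t :
  isProjective (LamP K t).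
Proof.
move=> M N e g [MD [MN [MND [Mdom [Mnull [Mlin [Mid Mcomp]]]]]]].
move=> [ND [NN [NND [Ndom [Nnull [Nlin [Nid Ncomp]]]]]]].
move=> [edom [enull [elin enat]]] [gdom [gnull [glin gnat]]] esurj.
have [m [Dm em]] := esurj t _ (gdom t (single K (ffid t)) I).
(* The normalised antisymmetriser: it kills null elements and fixes every class. *)
pose avg n (v : Vt K t n) := (t`!%:R)^-1 *: alt v.
pose h : famT (LamP K t) M := fun n (v : Vt K t n) => \sum_y avg n v y *: Fact M y m.
have Dy n (y : {ffun 'I_t -> 'I_n}) : Fdom M n (Fact M y m) by exact: Mdom.
exists h; split; first split.
- move=> n x _; apply: (subspace_sum (MD n)) => y; exact: (subspaceZ _ (MD n)).
- split=> [n x /(LamP_null charK0) ax|].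
    rewrite /h big1; first by case: (MN n).
    by move=> y _; rewrite /avg ax scaler0 ffunE scale0r.
  split=> [n a x y _ _|p n f x _].
    rewrite [X in Fnull _ _ X](_ : _ = 0); first by case: (MN n).
    apply/eqP; rewrite subr_eq0; apply/eqP; rewrite /h scaler_sumr -big_split /=.
    apply: eq_bigr => z _; rewrite scalerA -scalerDl; congr (_ *: _).
    by rewrite /avg linearP !ffunE /= /GRing.scale /= mulrDr mulrCA.
  rewrite (_ : h n _ = \sum_z avg p x z *: Fact M (ffcomp f z) m); last first.
    rewrite -(sum_pushT f (avg p x) (fun y => Fact M y m)).
    by apply: eq_bigr => y _; rewrite /avg /= alt_pushT linearZ.
  apply: (subspace_trans (N := Fnull M n)
    (y := \sum_z avg p x z *: Fact M f (Fact M z m))) => //.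
    by apply: (subspace_sum_sub (N := Fnull M n)) => // z; exact: Mcomp.
  rewrite -opprB -scaleN1r; apply: (subspaceZ _ (MN n)).
  by apply: (linear_modulo_sum (D := Fdom M p)) => // a u v; exact: Mlin.
move=> n x _.
(* Modulo null elements, [e (h x)] is moved through the combination of the [e (Fact M y m)], then
   that of the [g (single K y)], then [g (avg n x)], to [g x]. *)
apply: (subspace_trans (N := Fnull N n) (y := \sum_y avg n x y *: e n (Fact M y m))) => //.
  by apply: (linear_modulo_sum (D := Fdom M n)) => // a u v; exact: elin.
apply: (subspace_trans (N := Fnull N n) (y := \sum_y avg n x y *: g n (single K y))) => //.
  apply: (subspace_sum_sub (N := Fnull N n)) => // y.
  apply: (subspace_trans (N := Fnull N n) (y := Fact N y (e t m))) => //; first exact: enat.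
  apply: (subspace_trans (N := Fnull N n) (y := Fact N y (g t (single K (ffid t))))) => //.
    apply: (linear_moduloB (D := Fdom N t)) => //; first by move=> a u v; exact: Nlin.
    + exact: edom.
    + exact: gdom.
    + exact: Nnull.
  rewrite -opprB -scaleN1r; apply: (subspaceZ _ (NN n)).
  by have := gnat _ _ y (single K (ffid t)) I; rewrite /= pushT_single_id.
apply: (subspace_trans (N := Fnull N n) (y := g n (avg n x))) => //.
  rewrite -opprB -scaleN1r; apply: (subspaceZ _ (NN n)).
  rewrite {1}[avg n x]Vt_sum_single.
  by apply: (linear_modulo_sum (D := Fdom (LamP K t) n)) => // a u v; exact: glin.
apply: (linear_moduloB (D := Fdom (LamP K t) n)) => //; first by move=> a u v; exact: glin.
apply: gnull; apply/LamP_null => //; rewrite linearB linearZ /= alt_alt scalerA.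
by rewrite mulVf ?fact_neq0 // scale1r subrr.
Qed.

(** * The projective cover *)

(** The image is saturated by null elements, as a submodule must contain them; its being everything
    is surjectivity of [g]. *)
Lemma image_isSubmod (K : fieldType) (charK0 : [pchar K] =i pred0) t (M : FAraw K)
    (g : famT M (LamP K t)) :
  isFAmod M -> isHom g ->
  isSubmod (LamP K t) (fun n y => exists x, Fdom M n x /\ Fnull (LamP K t) n (g n x - y)).
Proof.
move=> [MD [_ [_ [Mdom _]]]] [gdom [_ [glin gnat]]].
have Pnull n : subspaceP (Fnull (LamP K t) n) by exact: spanP_subspace.
have g0 n : Fnull (LamP K t) n (g n 0).
  by apply: (linear_modulo0 (D := Fdom M n)) => // a u v; exact: glin.
split; first split.
- by exists 0; rewrite subr0; split=> //; case: (MD n).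
- move=> a y1 y2 [x1 [Dx1 xy1]] [x2 [Dx2 xy2]]; exists (a *: x1 + x2).
  split; first by case: (MD n) => _; apply.
  apply: (subspace_trans (y := a *: g n x1 + g n x2)) => //; first exact: glin.
  rewrite opprD addrACA -scalerBr; apply: subspaceD => //; exact: subspaceZ.
split=> //; split=> [n y ny|m n f y [x [Dx xy]]].
  exists 0; split; first by case: (MD n).
  exact: subspaceB.
exists (Fact M f x); split; first exact: Mdom.
apply: (subspace_trans (N := Fnull (LamP K t) n) (y := pushT f (g m x))) => //.
  exact: gnat.
move/(LamP_null charK0): xy => xy; apply/LamP_null => //.
by rewrite /= -linearB alt_pushT xy linear0.
Qed.

(** For positive $t$ the source is a line over $t$ points, and its generator has nonzero image. *)
Lemma dMap_hinj_top (K : fieldType) (charK0 : [pchar K] =i pred0) t (v : Vt K t t) :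
  Fnull (LamPbarPred K t) t (dMap K t t v) -> alt v = 0.
Proof.
case: t v => [|s] v; first by case=> // v0; rewrite (v0 : v = 0) linear0.
move=> /(LamPbar_null charK0)[_]; rewrite -/(koszul _) alt_koszul.
have [k ->] := alt_top v; rewrite linearZ /= -alt_koszul => /eqP.
by rewrite scaler_eq0 (negPf (alt_koszul_single_id_neq0 _ _)) orbF => /eqP ->; rewrite scale0r.
Qed.

Lemma dMap_isProjCover (K : fieldType) (charK0 : [pchar K] =i pred0) t :
  isProjCover (dMap K t).
Proof.
split; first exact: LamP_isProjective.
split; first exact: dMap_isHom.
split; first exact: dMap_hsurj.
move=> M g Mmod ghom dg_surj n y _; move: n y.
apply: LamP_generated; first exact: image_isSubmod.
have [ddom [dnull [dlin _]]] := dMap_isHom charK0 t.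
have [_ [Nnull _]] := LamPbarPred_isFAmod charK0 t.
(* Some [g t x] has the same image under [dMap] as the generator; injectivity over $t$ points puts
   the generator in the image of [g]. *)
have [x [Dx xe]] := dg_surj t _ (ddom t (single K (ffid t)) I).
exists x; split=> //; apply/LamP_null => //; apply: dMap_hinj_top => //.
pose u : FV (LamP K t) t := single K (ffid t).
have := dlin t (-1) u (g t x) I I; rewrite !scaleN1r ![- _ + _]addrC => dl.
by have := subspaceD (Nnull t) dl xe; rewrite subrK.
Qed.

Theorem mainTheorem10 (K : fieldType) (charK0 : [pchar K]%R =i pred0) (t : nat) :
  isFAmod (LamPbar K t) /\ isFAmod (LamP K t) /\ isFAmod (LamPbarPred K t) /\
  isHom (inclMap K t) /\ isHom (dMap K t) /\
  isSES (inclMap K t) (dMap K t) /\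
  isSimple (LamPbarPred K t) /\
  isProjCover (dMap K t) /\
  isProjective (LamP K t) /\ isIndecomposable (LamP K t).
Proof.
split; first exact: LamPbar_isFAmod.
split; first exact: LamP_isFAmod.
split; first exact: LamPbarPred_isFAmod.
split; first exact: inclMap_isHom.
split; first exact: dMap_isHom.
split; first exact: LamP_SES.
split; first exact: LamPbarPred_isSimple.
split; first exact: dMap_isProjCover.
split; first exact: LamP_isProjective.
exact: LamP_isIndecomposable.
Qed.
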